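(* For any connected graph $G$ with $n\geq 3$ vertices, $tr(G)\leq 2n-2$, and the bound is tight (i.e. equality is attained by some such graph).
   Context: All graphs are finite, simple and undirected. $d(u,v)$ denotes the usual shortest-path distance. The triameter of a connected graph $G=(V,E)$ on at least $3$ vertices is $tr(G)=\max\{d(u,v)+d(v,w)+d(u,w): u,v,w\in V\}$. *)

(* Defs.v *)
From mathcomp Require Import all_boot.

Set Implicit Arguments.
Unset Strict Implicit.
Unset Printing Implicit Defensive.

Record sgraph := SGraph {
  vertex :> finType;
  adj : rel vertex;
  adj_sym : symmetric adj;
  adj_irrefl : irreflexive adj
}.

Definition connected (G : sgraph) : Prop :=
  forall u v : G, connect (@adj G) u v.

(* In the path [u :: p] the number of edges is [size p]. *)
Definition is_path (G : sgraph) (u v : G) (p : seq G) : bool :=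
  [&& path (@adj G) u p, uniq (u :: p) & last u p == v].

(* Every path has fewer than #|G| edges, so the value #|G| is taken only when
   u and v are in distinct components; see [distP]. *)
Definition dist (G : sgraph) (u v : G) : nat :=
  \big[minn/#|G|]_(k < #|G| | [exists p : k.-tuple G, is_path u v p]) k.

(* The vertices u, v, w are not required to be distinct. *)
Definition triameter (G : sgraph) : nat :=
  \max_(u : G) \max_(v : G) \max_(w : G) (dist u v + dist v w + dist u w).

Lemma dist_le_path (G : sgraph) (u v : G) (p : seq G) :
  is_path u v p -> dist u v <= size p.
Proof.
move=> Hp; have lt_p : size p < #|G|.
  case/and3P: Hp => _ Up _.
  by rewrite -[(size p).+1]/(size (u :: p)) -(card_uniqP Up) max_card.
have : Ordinal lt_p \in index_enum 'I_#|G| by rewrite mem_index_enum.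
rewrite /dist; elim: (index_enum _) => // k s IHs.
rewrite big_cons inE => /predU1P[<- | /IHs le_s].
  by rewrite ifT ?geq_minl //; apply/existsP; exists (in_tuple p).
by case: ifP => // _; rewrite geq_min le_s orbT.
Qed.

Lemma distP (G : sgraph) (u v : G) : connected G ->
  (exists2 p, is_path u v p & size p = dist u v) /\
  (forall p, is_path u v p -> dist u v <= size p).
Proof.
move=> cG; split; last exact: dist_le_path.
have lt_d : dist u v < #|G|.
  have /connectP[p Hp ->] := cG u v.
  case/shortenP: Hp => q Hq Uq _.
  have Pq : is_path u (last u q) q by rewrite /is_path Hq Uq eqxx.
  apply: leq_ltn_trans (dist_le_path Pq) _.
  by rewrite -[(size q).+1]/(size (u :: q)) -(card_uniqP Uq) max_card.
suff: dist u v = #|G| \/ exists2 p, is_path u v p & size p = dist u v.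
  by case=> // eq_d; rewrite eq_d ltnn in lt_d.
rewrite {lt_d} /dist; elim/big_ind: _ => [|x y Hx Hy|k /existsP[p Hp]].
- by left.
- by rewrite /minn; case: ifP.
- by right; exists p; rewrite ?size_tuple.
Qed.

(* Main.v *)
Require Import Defs.
From mathcomp Require Import all_boot zify.

(** Three vertices [u], [v], [w] of a connected graph are joined by a subtree: a
    shortest path from [u] to [v], together with a branch that leaves [w] and
    stops at the first vertex [x] of that path it meets ([card_tripod]).  Going
    around this tree from [u] to [v] to [w] and back uses every edge twice, so
    the three distances sum to at most twice its number of edges
    ([dist_sum_le_tripod]); and a tree inside a graph with [n] vertices has at
    most [n - 1] edges.

    The bound is attained by the path on [n] vertices.  Each step along it
    changes the position by one, so its two ends are at distance [n - 1], and
    the triple formed by the two ends, one of them repeated, has distance sum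
    [2 * (n - 1)]. *)

(** * Distances and walks *)

(** Removing the loops of a walk leaves a path that is no longer than it. *)
Lemma dist_le_walk {G : sgraph} {u : G} {p : seq G} :
  path (@adj G) u p -> dist u (last u p) <= size p.
Proof.
case/shortenP=> q Hq Uq sub_qp.
have Pq : is_path u (last u q) q by rewrite /is_path Hq Uq eqxx.
apply: leq_trans (dist_le_path Pq) _.
exact: uniq_leq_size (subseq_uniq (subseq_cons q u) Uq) sub_qp.
Qed.

Lemma dist_walk {G : sgraph} (u v : G) : connected G ->
  exists p, [/\ path (@adj G) u p, uniq (u :: p), last u p = v
              & size p = dist u v].
Proof.
move=> cG; have [[p /and3P[Hp Up /eqP Lp] Sp] _] := distP u v cG.
by exists p.
Qed.

Lemma dist_sym {G : sgraph} (u v : G) : connected G -> dist u v = dist v u.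
Proof.
move=> cG.
have le_dist (x y : G) : dist x y <= dist y x.
  have [p [Hp _ <- <-]] := dist_walk y x cG.
  have Hr : path (@adj G) (last y p) (rev (belast y p)).
    by rewrite rev_path -(eq_path (@adj_sym G)).
  have := dist_le_walk Hr; rewrite size_rev size_belast.
  by case: p {Hp Hr} => [|z p] //=; rewrite rev_cons last_rcons.
by apply/eqP; rewrite eqn_leq !le_dist.
Qed.

Lemma dist_triangle {G : sgraph} (u v w : G) : connected G ->
  dist u w <= dist u v + dist v w.
Proof.
move=> cG; have [p [Hp _ Lp <-]] := dist_walk u v cG.
have [q [Hq _ Lq <-]] := dist_walk v w cG.
have Hpq : path (@adj G) u (p ++ q) by rewrite cat_path Hp Lp Hq.
by have := dist_le_walk Hpq; rewrite last_cat Lp Lq size_cat.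
Qed.

(** * The upper bound *)

(** The cut at the first element satisfying [a] is a prefix of the sequence, so
    that it inherits being a path and being duplicate-free. *)
Lemma first_hit {T : Type} (a : pred T) {w : T} {q : seq T} : a (last w q) ->
  exists q1 q2, [/\ q = q1 ++ q2, a (last w q1) & ~~ has a (belast w q1)].
Proof.
elim: q w => [|y q IHq] w aq; first by exists [::], [::].
have [aw | naw] := boolP (a w); first by exists [::], (y :: q).
have [q1 [q2 [-> aq1 nq1]]] := IHq y aq.
by exists (y :: q1), q2; rewrite /= negb_or naw.
Qed.

(** A path from [w] to [u], cut at its first vertex in [u :: p], shares only its
    end with [u :: p].  All its other vertices are new ones, as many as its
    edges, and there are at least [dist w x] of those. *)
Lemma card_tripod {G : sgraph} (w : G) {u : G} {p : seq G} : connected G ->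
    uniq (u :: p) ->
  exists2 x, x \in u :: p & dist w x + size (u :: p) <= #|G|.
Proof.
move=> cG Up; have [q [Hq Uq Lq _]] := dist_walk w u cG.
have q_hits : last w q \in u :: p by rewrite Lq mem_head.
have [q1 [q2 [def_q q1p disj]]] := first_hit (mem (u :: p)) q_hits.
exists (last w q1); first exact: q1p.
have Hq1 : path (@adj G) w q1 by move: Hq; rewrite def_q cat_path => /andP[].
have Uq1 : uniq (belast w q1).
  move: Uq; rewrite def_q -cat_cons cat_uniq lastI rcons_uniq.
  by case/andP=> /andP[].
apply: leq_trans (leq_add (dist_le_walk Hq1) (leqnn _)) _.
have Uqp : uniq (belast w q1 ++ (u :: p)).
  by rewrite cat_uniq Uq1 Up has_sym disj.
by rewrite -(size_belast w) -size_cat -(card_uniqP Uqp) max_card.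
Qed.

Lemma dist_sum_le_tripod {G : sgraph} {u v : G} (w : G) {x : G} {p : seq G} :
    connected G -> path (@adj G) u p -> last u p = v -> x \in u :: p ->
  dist u v + dist v w + dist u w <= 2 * (size p + dist w x).
Proof.
move=> cG Hp Lp xp; case/splitPl: xp Hp Lp => p1 p2 Lp1.
rewrite cat_path last_cat Lp1 size_cat => /andP[Hp1 Hp2] Lp2.
have le_ux := dist_le_walk Hp1; have le_xv := dist_le_walk Hp2.
rewrite Lp1 in le_ux; rewrite Lp2 in le_xv.
have := dist_triangle u x v cG.
have := dist_triangle u x w cG; have := dist_triangle v x w cG.
rewrite (dist_sym x w cG) (dist_sym v x cG); lia.
Qed.

Lemma triameter_le {G : sgraph} : connected G -> triameter G <= 2 * #|G| - 2.
Proof.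
move=> cG; apply/bigmax_leqP=> u _; apply/bigmax_leqP=> v _.
apply/bigmax_leqP=> w _.
have [p [Hp Up Lp _]] := dist_walk u v cG.
have [x xp] := card_tripod w cG Up.
have := dist_sum_le_tripod w cG Hp Lp xp.
rewrite /=; lia.
Qed.

(** Two vertices already bound the triameter from below, because the triple may
    repeat one of them. *)
Lemma double_dist_le_triameter {G : sgraph} (u v : G) : connected G ->
  2 * dist u v <= triameter G.
Proof.
move=> cG; rewrite /triameter.
apply: leq_trans (leq_bigmax u); apply: leq_trans (leq_bigmax v).
apply: leq_trans (leq_bigmax u).
rewrite (dist_sym v u cG); lia.
Qed.

(** * The path on [n] vertices *)

Definition path_adj (n : nat) : rel 'I_n :=
  fun i j => (i.+1 == j) || (j.+1 == i).

Lemma path_adj_sym n : symmetric (path_adj n).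
Proof. by move=> i j; rewrite /path_adj orbC. Qed.

Lemma path_adj_irrefl n : irreflexive (path_adj n).
Proof. by move=> i; rewrite /path_adj orbb gtn_eqF. Qed.

Definition path_graph (n : nat) : sgraph :=
  SGraph (path_adj_sym n) (path_adj_irrefl n).

Lemma path_graph_connected n : connected (path_graph n).
Proof.
case: n => [|n]; first by case.
have from0 k : k < n.+1 -> connect (path_adj n.+1) ord0 (inord k).
  elim: k => [|k IHk] lt_k.
    by rewrite (_ : inord 0 = ord0) //; apply/val_inj; rewrite /= inordK.
  apply: connect_trans (IHk (ltnW lt_k)) (connect1 _).
  by rewrite /path_adj !inordK ?eqxx // ltnW.
have conn0 i : connect (path_adj n.+1) ord0 i.
  by rewrite -[i]inord_val; apply: from0.
move=> u v; apply: connect_trans (conn0 v).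
by rewrite (sym_connect_sym (path_adj_sym n.+1)); apply: conn0.
Qed.

Lemma path_adj_last_le {n} {i : 'I_n} {p : seq 'I_n} :
  path (path_adj n) i p -> last i p <= i + size p.
Proof.
elim: p i => [|j p IHp] i /=; first by rewrite addn0.
case/andP=> adj_ij /IHp; move: adj_ij; rewrite /path_adj.
case/orP=> /eqP; lia.
Qed.

Lemma path_graph_dist_ends n :
  n <= dist (ord0 : path_graph n.+1) (ord_max : path_graph n.+1).
Proof.
have [p [Hp _ Lp <-]] := dist_walk (ord0 : path_graph n.+1)
  (ord_max : path_graph n.+1) (path_graph_connected n.+1).
have := path_adj_last_le Hp; rewrite [last _ _]Lp /=; lia.
Qed.

Theorem theorem3p2 (n : nat) (hn : 3 <= n) :
  (forall G : sgraph, connected G -> #|G| = n -> triameter G <= 2 * n - 2) /\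
  (exists G : sgraph, [/\ connected G, #|G| = n & triameter G = 2 * n - 2]).
Proof.
split=> [G cG <- | ]; first exact: triameter_le.
case: n hn => // n _; exists (path_graph n.+1).
have cG := path_graph_connected n.+1.
have cardG : #|path_graph n.+1| = n.+1 by exact: card_ord.
split=> //; have := triameter_le cG; rewrite cardG.
have := double_dist_le_triameter
  (ord0 : path_graph n.+1) (ord_max : path_graph n.+1) cG.
have := path_graph_dist_ends n; lia.
Qed.
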